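(* Every modal rule system $\mathtt{M}\in \mathbf{NExt}(\mathtt{GL_R})$ is axiomatisable over $\mathtt{GL_R}$ by some set of modal pre-stable canonical rules of the form $\xi^+(\mathfrak{A}, D^{\square^+}, D^\square)$, where $\mathfrak{A}\in \mathsf{K4}$.
   Context: $\mathtt{GL}=\mathtt{K}\oplus\square(\square p\to p)\to\square p$; $\mathtt{GL_R}$ is the least modal rule system containing $/\varphi$ for $\varphi\in\mathtt{GL}$; $\mathsf{K4}$ is the class of transitive modal algebras. Write $\square^+\varphi:=\square\varphi\land\varphi$. For a finite modal algebra $\mathfrak{A}$ and $D^{\square^+},D^\square\subseteq A$, the modal pre-stable canonical rule $\xi^+(\mathfrak{A},D^{\square^+},D^\square)$ is $\Gamma/\Delta$ with fresh variables $p_a$ ($a\in A$), where $\Gamma=\{p_{a\land b}\leftrightarrow p_a\land p_b,\ p_{a\lor b}\leftrightarrow p_a\lor p_b:a,b\in A\}\cup\{p_{\neg a}\leftrightarrow\neg p_a:a\in A\}\cup\{p_{\square^+a}\to\square^+p_a:a\in A\}\cup\{\square^+p_a\to p_{\square^+a}:a\in D^{\square^+}\}\cup\{p_{\square a}\leftrightarrow\square p_a:a\in D^\square\}$ and $\Delta=\{p_a:a\in A\smallsetminus\{1\}\}$. *)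

(* Defs.v *)
From HB Require Import structures.
From mathcomp Require Import all_boot all_order finmap.
From mathcomp Require Import classical_sets.
Set Implicit Arguments.
Unset Strict Implicit.
Unset Printing Implicit Defensive.

Local Open Scope fset_scope.
Local Open Scope classical_set_scope.

Declare Scope modal_scope.
Delimit Scope modal_scope with M.

Inductive form : Type :=
| Var of nat
| FBot
| FTop
| FAnd of form & form
| FOr of form & form
| FNeg of form
| FBox of form.

Bind Scope modal_scope with form.

Definition FImp (p q : form) : form := FOr (FNeg p) q.
Definition FIff (p q : form) : form := FAnd (FImp p q) (FImp q p).
Definition FBoxp (p : form) : form := FAnd (FBox p) p.

Notation "p ∧ q" := (FAnd p q) (at level 40, left associativity) : modal_scope.
Notation "p ∨ q" := (FOr p q) (at level 50, left associativity) : modal_scope.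
Notation "¬ p" := (FNeg p) (at level 35, right associativity) : modal_scope.
Notation "□ p" := (FBox p) (at level 35, right associativity) : modal_scope.
Notation "□⁺ p" := (FBoxp p) (at level 35, right associativity) : modal_scope.
Notation "p → q" := (FImp p q) (at level 60, right associativity) : modal_scope.
Notation "p ↔ q" := (FIff p q) (at level 65, no associativity) : modal_scope.

Fixpoint form_encode (p : form) : GenTree.tree nat :=
  match p with
  | Var n => GenTree.Leaf n
  | FBot => GenTree.Node 0 [::]
  | FTop => GenTree.Node 1 [::]
  | FAnd q r => GenTree.Node 2 [:: form_encode q; form_encode r]
  | FOr q r => GenTree.Node 3 [:: form_encode q; form_encode r]
  | FNeg q => GenTree.Node 4 [:: form_encode q]
  | FBox q => GenTree.Node 5 [:: form_encode q]
  end.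

Fixpoint form_decode (t : GenTree.tree nat) : form :=
  match t with
  | GenTree.Leaf n => Var n
  | GenTree.Node 1 _ => FTop
  | GenTree.Node 2 [:: t1; t2] => FAnd (form_decode t1) (form_decode t2)
  | GenTree.Node 3 [:: t1; t2] => FOr (form_decode t1) (form_decode t2)
  | GenTree.Node 4 [:: t1] => FNeg (form_decode t1)
  | GenTree.Node 5 [:: t1] => FBox (form_decode t1)
  | _ => FBot
  end.

Lemma form_encodeK : cancel form_encode form_decode.
Proof. by elim=> //= [p -> q -> | p -> q -> | p -> | p ->]. Qed.

HB.instance Definition _ := Countable.copy form (can_type form_encodeK).

Fixpoint subst (s : nat -> form) (p : form) : form :=
  match p with
  | Var n => s n
  | FBot => FBot
  | FTop => FTop
  | FAnd q r => FAnd (subst s q) (subst s r)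
  | FOr q r => FOr (subst s q) (subst s r)
  | FNeg q => FNeg (subst s q)
  | FBox q => FBox (subst s q)
  end.

(* Boxed formulas are treated as propositional atoms, so that [tautology]
   covers all substitution instances of classical tautologies. *)
Fixpoint beval (v : form -> bool) (p : form) : bool :=
  match p with
  | Var n => v (Var n)
  | FBot => false
  | FTop => true
  | FAnd q r => beval v q && beval v r
  | FOr q r => beval v q || beval v r
  | FNeg q => ~~ beval v q
  | FBox q => v (FBox q)
  end.

Definition tautology (p : form) : Prop := forall v, beval v p.

Record normal_modal_logic (L : set form) : Prop := NormalModalLogic {
  nml_taut : forall p, tautology p -> L p;
  nml_K : forall p q, L (□ (p → q) → (□ p → □ q))%M;
  nml_mp : forall p q, L p -> L (p → q)%M -> L q;
  nml_nec : forall p, L p -> L (□ p)%M;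
  nml_subst : forall s p, L p -> L (subst s p)
}.

Definition logic_oplus (L S : set form) : set form :=
  [set p | forall N, normal_modal_logic N -> L `<=` N -> S `<=` N -> N p].

Definition logicK : set form :=
  [set p | forall N, normal_modal_logic N -> N p].

Definition GL : set form :=
  logic_oplus logicK [set (□ (□ Var 0 → Var 0) → □ Var 0)%M].

(* The rule Γ/Δ is the pair (Γ, Δ). *)
Definition rule : Type := ({fset form} * {fset form})%type.

Definition subst_fset (s : nat -> form) (G : {fset form}) : {fset form} :=
  [fset subst s p | p in G].

Record modal_rule_system (M : set rule) : Prop := ModalRuleSystem {
  mrs_refl : forall p : form, M ([fset p], [fset p]);
  mrs_weak : forall G D G' D' : {fset form},
    M (G, D) -> M ((G `|` G')%fset, (D `|` D')%fset);
  mrs_cut : forall (G D : {fset form}) (p : form),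
    M (G, (p |` D)%fset) -> M ((p |` G)%fset, D) -> M (G, D);
  mrs_subst : forall s (G D : {fset form}),
    M (G, D) -> M (subst_fset s G, subst_fset s D);
  mrs_K : forall p, logicK p -> M (fset0, [fset p]);
  mrs_nec : forall p : form, M ([fset p], [fset (□ p)%M]);
  mrs_mp : forall p q : form, M ([fset p; (p → q)%M], [fset q])
}.

Definition logic_rules (L : set form) : set rule :=
  [set r | forall M, modal_rule_system M ->
     (forall p, L p -> M (fset0, [fset p])) -> M r].

Definition GLR : set rule := logic_rules GL.

Definition NExt (M : set rule) : set (set rule) :=
  [set N | modal_rule_system N /\ M `<=` N].

Definition rules_oplus (M X : set rule) : set rule :=
  [set r | forall N, NExt M N -> X `<=` N -> N r].

Definition axiomatised_over (M X N : set rule) : Prop := N = rules_oplus M X.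

(* The one-element algebra (\bot = \top) is allowed. *)
HB.mixin Record isModalAlgebra d (T : Type) of Order.CTBDistrLattice d T := {
  box : T -> T;
  box1 : box \top%O = \top%O;
  boxI : forall a b : T, box (a `&` b)%O = (box a `&` box b)%O
}.

#[short(type="modalAlgebraType")]
HB.structure Definition ModalAlgebra d :=
  { T of Order.CTBDistrLattice d T & isModalAlgebra d T }.

#[short(type="finModalAlgebraType")]
HB.structure Definition FinModalAlgebra d :=
  { T of ModalAlgebra d T & Finite T }.

Definition boxp d (A : modalAlgebraType d) (a : A) : A := (box a `&` a)%O.

Definition K4 d (A : modalAlgebraType d) : Prop :=
  forall a : A, (box a <= box (box a))%O.

Section PrestableCanonicalRule.
Variables (d : Order.disp_t) (A : finModalAlgebraType d).

(* Rules are closed under substitution in a rule system, so any other choice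
   of pairwise distinct variables would do. *)
Definition pvar (a : A) : form := Var (enum_rank a).

Local Notation p_ := pvar.

Definition prestable_prem (Dboxp Dbox : {set A}) : {fset form} :=
  ([fset (p_ (a `&` b)%O ↔ p_ a ∧ p_ b)%M | a : A, b : A] `|`
  [fset (p_ (a `|` b)%O ↔ p_ a ∨ p_ b)%M | a : A, b : A] `|`
  [fset (p_ (~` a)%O ↔ ¬ p_ a)%M | a : A] `|`
  [fset (p_ (boxp a) → □⁺ p_ a)%M | a : A] `|`
  [fset (□⁺ p_ a → p_ (boxp a))%M | a in Dboxp] `|`
  [fset (p_ (box a) ↔ □ p_ a)%M | a in Dbox])%fset.

Definition prestable_concl : {fset form} :=
  [fset p_ a | a in [pred a : A | a != \top%O]].

Definition prestable_rule (Dboxp Dbox : {set A}) : rule :=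
  (prestable_prem Dboxp Dbox, prestable_concl).

End PrestableCanonicalRule.

Definition K4_prestable_rules : set rule :=
  [set r | exists (d : Order.disp_t) (A : finModalAlgebraType d)
             (Dboxp Dbox : {set A}),
             K4 A /\ r = prestable_rule Dboxp Dbox].

(* Main.v *)
(** Let N be another rule system extending GLR and suppose that a rule G/D
    belongs to M but not to N.  Lindenbaum's lemma yields a set T of formulas
    closed under N, containing G and disjoint from D.  Let S be the closure of
    the rule under subformulas, and filter T through S: the points are the
    T-consistent truth assignments on S, and t sees u iff whenever t contains
    a boxed formula, u contains both this formula and what is under the box
    (Lemmon's transitive filtration, which only needs that GL proves
    transitivity).  Take for A the complex algebra of this finite transitive
    frame, for the first parameter the empty set and for the second one the
    set of values of the formulas whose box is in S.  Sending p_a to the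
    characteristic formula of a shows that N omits the pre-stable rule of A;
    sending each variable to p_a, for a its value in A, shows that a set of
    formulas closed under M which refutes the pre-stable rule of A also
    refutes G/D, so that M contains it.  Hence the pre-stable rules in M
    axiomatise M. *)

From HB Require Import structures.
Require Import Defs.
From mathcomp Require Import all_boot all_order finmap.
From mathcomp Require Import boolp classical_sets.

Set Implicit Arguments.
Unset Strict Implicit.
Unset Printing Implicit Defensive.

Import Order.SetSubsetOrder.

Local Open Scope classical_set_scope.

(** * Complex algebras of finite frames *)

(** A type alias indexed by [R], so that each relation on the same carrier gets its own modal
    algebra instance. *)
Definition frame_algebra (W : finType) (R : rel W) : Type := {set W}.

Section FrameAlgebra.
Variables (W : finType) (R : rel W).
Local Notation A := (frame_algebra R).

HB.instance Definition _ :=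
  Order.CTBDistrLattice.copy A (preorder.Order.SetSubsetOrder.type
  preorder.Order.SetSubsetOrder.subset_display W).
HB.instance Definition _ := Finite.copy A {set W}.

Definition frame_box (a : A) : A := [set t | [forall u,
  R t u ==> (u \in (a : {set W}))]]%SET.

Fact frame_box1 : frame_box \top%O = \top%O.
Proof. by apply/setP=> t; rewrite topEsubset !inE; apply/forallP=> u;
  rewrite inE implybT. Qed.

Fact frame_boxI (a b : A) : frame_box (a `&` b)%O = (frame_box a `&` frame_box
  b)%O.
Proof.
apply/setP=> t; rewrite !meetEsubset !inE;
  apply/forallP/andP=> [h|[/forallP h /forallP k] u].
- by split; apply/forallP=> u; move: (h u); rewrite inE;
    case: (R t u) => //= /andP[].
- by move: (h u) (k u); rewrite inE; case: (R t u) => //= -> ->.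
Qed.

HB.instance Definition _ := isModalAlgebra.Build _ A frame_box1 frame_boxI.

Lemma frame_algebra_K4 : transitive R -> K4 A.
Proof.
move=> trR a; rewrite leEsubset.
apply/fintype.subsetP => t; rewrite !inE => /forallP h; apply/forallP => u.
apply/implyP => tu; rewrite inE; apply/forallP => v; apply/implyP => uv.
by have /implyP -> := h v; last exact: trR tu uv.
Qed.

End FrameAlgebra.

(** * Sets of formulas closed under a rule system, and Lindenbaum's lemma *)

Definition rule_closed (M : set rule) (T : set form) : Prop :=
  forall G D : {fset form}, M (G, D) ->
    (forall p, p \in G -> T p) -> exists2 p, p \in D & T p.

Section Lindenbaum.
Variables (M : set rule) (M_sys : modal_rule_system M).

Lemma rule_weaken (G D G' D' : {fset form}) :
  (G `<=` G')%fset -> (D `<=` D')%fset -> M (G, D) -> M (G', D').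
Proof.
by move=> /fsetUidPr <- /fsetUidPr <-; exact: mrs_weak.
Qed.

(** A formula goes to the right exactly when adding it on the left would give a rule of [M]; cut
    then keeps the pair outside [M]. *)
Definition lindenbaum_step (r : rule) (n : nat) : rule :=
  if choice.unpickle n is Some p then
    if `[< M (p |` r.1, r.2)%fset >] then (r.1, p |` r.2)%fset
    else (p |` r.1, r.2)%fset
  else r.

Fixpoint lindenbaum_chain (r : rule) (n : nat) : rule :=
  if n is m.+1 then lindenbaum_step (lindenbaum_chain r m) m else r.

Lemma lindenbaum_chain_notin r n : ~ M r -> ~ M (lindenbaum_chain r n).
Proof.
move=> Mr; elim: n => //= n; case: (lindenbaum_chain r n) => G D IH.
rewrite /lindenbaum_step; case: (choice.unpickle n) => //= p.
by case: asboolP => // Mp Mp'; apply: IH; exact: mrs_cut Mp' Mp.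
Qed.

Lemma lindenbaum_chain_le r m n : (m <= n)%N ->
  ((lindenbaum_chain r m).1 `<=` (lindenbaum_chain r n).1)%fset /\
  ((lindenbaum_chain r m).2 `<=` (lindenbaum_chain r n).2)%fset.
Proof.
move=> /subnK <-; elim: (n - m)%N => [|k [IH1 IH2]]; first by split;
  apply: fsubset_refl.
rewrite addSn /= /lindenbaum_step; case: (choice.unpickle (k + m)) => [p|] //=.
by case: ifP => _ /=; split; rewrite ?fsubsetU ?IH1 ?IH2 ?orbT.
Qed.

Lemma lindenbaum_chain_total r (p : form) :
  p \in (lindenbaum_chain r (choice.pickle p).+1).1 \/
  p \in (lindenbaum_chain r (choice.pickle p).+1).2.
Proof.
rewrite /= /lindenbaum_step choice.pickleK; case: ifP => _ /=; rewrite fset1U1;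
  by [right|left].
Qed.

Lemma lindenbaum (G D : {fset form}) : ~ M (G, D) ->
  exists T : set form, [/\ rule_closed M T, forall p, p \in G -> T p
                         & forall p, p \in D -> ~ T p].
Proof.
move=> MGD; pose c := lindenbaum_chain (G, D).
have cM n : ~ M (c n) by exact: lindenbaum_chain_notin.
(* A formula on both sides would make a later stage a weakening of [p / p], hence a rule of [M]. *)
have c_disj m n p : p \in (c m).1 -> p \in (c n).2 -> False.
  move=> pm pn; apply: (cM (maxn m n)).
  have [le1 _] := lindenbaum_chain_le (G, D) (leq_maxl m n).
  have [_ le2] := lindenbaum_chain_le (G, D) (leq_maxr m n).
  rewrite [c _]surjective_pairing; apply: rule_weaken (mrs_refl M_sys p).
    by rewrite fsub1set (fsubsetP le1).
  by rewrite fsub1set (fsubsetP le2).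
exists [set p | exists n, p \in (c n).1];
  split => [G' D' MGD' G'T|p pG|p pD [n pn]].
- have [//|nD'] := pselect (exists2 p, p \in D' & exists n, p \in (c n).1).
  (* By stage [N] every formula of [G'] and [D'] has been placed: [p] is decided in the step leaving
     stage [choice.pickle p], whence the successor. So stage [N] would be a weakening of [G'/D']. *)
  pose N := \max_(p <- G' ++ D') (choice.pickle p).+1; case: (cM N).
  rewrite [c N]surjective_pairing; apply: rule_weaken MGD'.
  + apply/fsubsetP => p pG'.
    have pN : ((choice.pickle p).+1 <= N)%N.
      by apply: (leq_bigmax_seq (F := fun q : form => (choice.pickle q).+1)) =>
        //; rewrite mem_cat pG'.
    have [n pn] := G'T p pG'.
    have [//|pn'] := lindenbaum_chain_total (G, D) p;
      first exact: (fsubsetP (lindenbaum_chain_le (G, D) pN).1).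
    by case: (c_disj _ _ _ pn pn').
  + apply/fsubsetP => p pD'.
    have pN : ((choice.pickle p).+1 <= N)%N.
      by apply: (leq_bigmax_seq (F := fun q : form => (choice.pickle q).+1)) =>
        //; rewrite mem_cat pD' orbT.
    have [pn|] := lindenbaum_chain_total (G, D) p;
      last exact: (fsubsetP (lindenbaum_chain_le (G, D) pN).2).
    by case: nD'; exists p => //; exists (choice.pickle p).+1.
- by exists 0.
- exact: c_disj pn (pD : p \in (c 0).2).
Qed.

End Lindenbaum.

(** * Normal theories and reasoning inside them *)

(** Closure under substitution is left out: a set produced by Lindenbaum's lemma behaves like truth
    under one fixed valuation and need not have it. *)
Record normal_theory (T : set form) : Prop := NormalTheory {
  nth_taut : forall p, tautology p -> T p;
  nth_K : forall p q, T (□ (p → q) → (□ p → □ q))%M;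
  nth_mp : forall p q, T p -> T (p → q)%M -> T q;
  nth_nec : forall p, T p -> T (□ p)%M
}.

Lemma normal_logic_theory L : normal_modal_logic L -> normal_theory L.
Proof. by case. Qed.

Lemma logicK_theory : normal_theory logicK.
Proof.
split=> [p pt|p q|p q Kp Kpq|p Kp] N hN.
- exact: nml_taut.
- exact: nml_K.
- by apply: (nml_mp hN (Kp N hN)); exact: Kpq.
- by apply: nml_nec => //; exact: Kp.
Qed.

Lemma rule_closed1 M T (G : {fset form}) p : rule_closed M T ->
  M (G, [fset p]%fset) -> (forall q, q \in G -> T q) -> T p.
Proof. by move=> MT MG /(MT _ _ MG)[q]; rewrite inE => /eqP ->. Qed.

Lemma rule_closed_thm M T p :
  rule_closed M T -> M (fset0, [fset p]%fset) -> T p.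
Proof. by move=> MT Mp; apply: rule_closed1 MT Mp _. Qed.

Lemma rule_closed_theory M T :
  modal_rule_system M -> rule_closed M T -> normal_theory T.
Proof.
move=> M_sys MT; have KT p : logicK p -> T p.
  by move=> Kp; apply: rule_closed_thm MT _; exact: mrs_K.
have [Kt KK _ _] := logicK_theory.
split=> [p /Kt/KT //|p q|p q Tp Tpq|p Tp]; first exact: KT (KK p q).
- apply: (rule_closed1 MT (mrs_mp M_sys p q)) => r.
  by rewrite !inE => /orP[] /eqP ->.
- apply: (rule_closed1 MT (mrs_nec M_sys p)) => r.
  by rewrite !inE => /eqP ->.
Qed.

Lemma beval_foldr_imp v C q :
  beval v (foldr FImp q C) = all (beval v) C ==> beval v q.
Proof. by elim: C => //= p C ->; case: (beval v p). Qed.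

Section Theory.
Variables (T : set form) (T_th : normal_theory T).

(** The iterated implication from [C] to [q] is a tautology, and its premises are detached one by
    one. This reduces derivations in [T] to Boolean case analysis with boxed formulas as atoms. *)
Lemma theory_entails (C : seq form) q : (forall p, p \in C -> T p) ->
  (forall v, all (beval v) C -> beval v q) -> T q.
Proof.
move=> CT Cq; have : T (foldr FImp q C).
  apply: nth_taut => // v; rewrite beval_foldr_imp; exact/implyP/Cq.
elim: C CT {Cq} => //= p C IH CT TC; apply: IH => [r rC|].
  by apply: CT; rewrite inE rC orbT.
by apply: nth_mp TC => //; apply: CT; rewrite mem_head.
Qed.

Lemma theory_box_imp C q : T (foldr FImp q C) ->
  T (foldr FImp (□ q)%M [seq (□ p)%M | p <- C]).
Proof.
move=> TCq; apply: (nth_mp T_th (nth_nec T_th TCq)) => {TCq}.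
elim: C => [|p C IH] /=; first by apply: nth_taut => // v /=; rewrite orNb.
apply: (theory_entails (C := [:: (□ (foldr FImp q C) →
  foldr FImp (□ q) [seq (□ p)%M | p <- C])%M;
    (□ (p → foldr FImp q C) → (□ p → □ foldr FImp q C))%M])).
  by move=> r; rewrite !inE => /orP[/eqP ->|/eqP ->] //; exact: nth_K.
move=> v /=; case: (v _) => //=; case: (v _) => //=; case: (v _) => //=.
by rewrite !andbT.
Qed.

End Theory.

(** The classical derivation with [q = □ p ∧ p]: since [□ q] gives [□ p], [p] implies [□ q → q];
    boxing this and applying Löb's axiom yields [□ p → □ q], and [□ q] gives [□ □ p]. *)
Lemma GL_trans p : GL (□ p → □ □ p)%M.
Proof.
move=> N hN _ axN; have thN := normal_logic_theory hN.
pose q : form := (□ p ∧ p)%M.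
have Lob : N (□ (□ q → q) → □ q)%M.
  by apply: (nml_subst hN (fun=> q) (p := (□ (□ Var 0 → Var 0) → □ Var 0)%M));
    exact: axN.
have qp : N (□ q → □ p)%M.
  apply: (theory_box_imp thN (C := [:: q])); apply: nth_taut => // v /=.
  by case: (v _); case: (beval v p).
have qbp : N (□ q → □ □ p)%M.
  apply: (theory_box_imp thN (C := [:: q])); apply: nth_taut => // v /=.
  by case: (v _); case: (beval v p).
have pq : N (□ p → □ (□ q → q))%M.
  apply: (theory_box_imp thN (C := [:: p])) => /=.
  apply: (theory_entails thN (C := [:: (□ q → □ p)%M])) => [r|v /=].
    by rewrite inE => /eqP ->.
  by case: (v _); case: (v _); case: (beval v p).
apply: (theory_entails thN (C := [:: (□ p → □ (□ q → q)); (□ (□ q → q) → □ q);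
  (□ q → □ □ p)]%M)).
  by move=> r; rewrite !inE => /or3P[] /eqP ->.
by move=> v /=; do !case: (v _) => //=.
Qed.

(** * Subformula closure *)

Fixpoint subforms (p : form) : seq form :=
  p :: match p with
       | FAnd q r | FOr q r => subforms q ++ subforms r
       | FNeg q | FBox q => subforms q
       | _ => [::]
       end.

Lemma subforms_refl p : p \in subforms p.
Proof. by case: p => *; rewrite mem_head. Qed.

Lemma subforms_trans p q : q \in subforms p -> {subset subforms q <= subforms
  p}.
Proof.
elim: p => [n|||p IHp r IHr|p IHp r IHr|p IHp|p IHp];
  rewrite in_cons => /predU1P[-> //|] // qp x xq; rewrite in_cons; apply/orP;
    right.
- by move: qp; rewrite !mem_cat => /orP[/IHp/(_ x xq)|/IHr/(_ x xq)] ->;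
    rewrite ?orbT.
- by move: qp; rewrite !mem_cat => /orP[/IHp/(_ x xq)|/IHr/(_ x xq)] ->;
    rewrite ?orbT.
- exact: IHp.
- exact: IHp.
Qed.

Definition sub_closed (S : {fset form}) : Prop :=
  forall p, p \in S -> {subset subforms p <= S}.

Definition sub_closure (S : {fset form}) : {fset form} :=
  [fset q in flatten [seq subforms p | p <- S]]%fset.

Lemma sub_closure_closed S : sub_closed (sub_closure S).
Proof.
move=> p; rewrite !inE => /flatten_mapP[r rS pr] q qp; rewrite !inE.
by apply/flatten_mapP; exists r => //; exact: subforms_trans qp.
Qed.

Lemma subset_sub_closure S p : p \in S -> p \in sub_closure S.
Proof.
by move=> pS; rewrite !inE; apply/flatten_mapP; exists p => //;
  exact: subforms_refl.
Qed.

(** * Transitive filtration of a theory through a finite set of formulas *)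

Section Filtration.
Variables (T : set form) (S : {fset form}).
Hypotheses (T_th : normal_theory T) (T4 : forall p, T (□ p → □ □ p)%M).
Hypothesis S_closed : sub_closed S.

Definition holds (t : {ffun S -> bool}) (p : form) : bool :=
  if insub p is Some x then t x else false.

Definition type_of (v : form -> bool) : {ffun S -> bool} :=
  [ffun x => beval v (val x)].

Lemma holds_type_of v p : p \in S -> holds (type_of v) p = beval v p.
Proof. by move=> pS; rewrite /holds insubT ffunE. Qed.

Definition type_form (t : {ffun S -> bool}) : form :=
  foldr FAnd FTop [seq if t x then val x else FNeg (val x) | x <- enum {: S}].

Lemma beval_type_form v t : beval v (type_form t) = (type_of v == t).
Proof.
have -> : beval v (type_form t) = all (fun x : S =>
  beval v (val x) == t x) (enum {: S}).
  rewrite /type_form; elim: (enum {: S}) => //= x s ->; congr (_ && _).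
  by case: (t x) => /=; case: beval.
apply/allP/eqP => [h|<- x _]; last by rewrite ffunE.
by apply/ffunP => x; rewrite ffunE; apply/eqP/h; rewrite mem_enum.
Qed.

Definition consistent (t : {ffun S -> bool}) : bool :=
  `[< ~ T (FNeg (type_form t)) >].

Definition world : finType := {t | consistent t}.

Definition world_of v (c : consistent (type_of v)) : world :=
  exist consistent (type_of v) c.

(** If no valuation satisfying [C] had type [t], then [C] would entail the negation of
    [type_form t], against the consistency of [t]. *)
Lemma world_val (t : world) (C : seq form) : (forall p, p \in C -> T p) ->
  exists2 v, all (beval v) C & type_of v = val t.
Proof.
move=> CT; have /asboolP nt := valP t; apply: contrapT => nv; apply: nt.
apply: (theory_entails T_th CT) => v Cv /=; rewrite beval_type_form.
by apply/eqP => vt; apply: nv; exists v.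
Qed.

(** Finitely many members of [T] which force the type of a valuation satisfying them to be a
    world. *)
Definition inconsistencies : seq form :=
  [seq FNeg (type_form t) | t <- enum [pred t | ~~ consistent t]].

Lemma inconsistenciesT p : p \in inconsistencies -> T p.
Proof.
case/mapP => t; rewrite mem_enum inE => nt ->.
by move: nt => /asboolP; exact: contrapT.
Qed.

Lemma inconsistenciesP v :
  all (beval v) inconsistencies -> consistent (type_of v).
Proof.
move=> /allP h; apply: contraT => nc.
have /h /= : FNeg (type_form (type_of v)) \in inconsistencies.
  by apply/mapP; exists (type_of v) => //; rewrite mem_enum.
by rewrite beval_type_form eqxx.
Qed.

(* Lemmon's relation; adding irreflexivity would make the filtration a GL frame,
   but then it would no longer contain the image of the original relation. *)
Definition acc (t u : world) : bool :=
  all (fun p => if p is FBox q then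
     holds (val t) p ==> holds (val u) p && holds (val u) q else true) S.

Lemma accP (t u : world) :
  reflect (forall q, FBox q \in S -> holds (val t) (FBox q) ->
             holds (val u) (FBox q) /\ holds (val u) q) (acc t u).
Proof.
apply: (iffP allP) => [h q qS tq|h [] // q qS]; last first.
  by apply/implyP => tq; apply/andP; exact: h.
by have /implyP/(_ tq)/andP := h _ qS.
Qed.

Lemma acc_trans : transitive acc.
Proof.
move=> u t w /accP tu /accP uw; apply/accP => q qS tq.
by apply: uw => //; case: (tu q qS tq).
Qed.

Definition char_form (a : {set world}) : form :=
  foldr FOr FBot [seq type_form (val t) | t <- enum a].

Lemma beval_char_form v (c : consistent (type_of v)) (a : {set world}) :
  beval v (char_form a) = (world_of c \in a).
Proof.
have -> : beval v (char_form a) = has (fun t => type_of v == val t) (enum a).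
  rewrite /char_form; elim: (enum a) => //= t s ->.
  by rewrite beval_type_form.
apply/hasP/idP => [[t ta /eqP vt]|va].
  suff -> : world_of c = t by rewrite -mem_enum.
  exact: val_inj.
by exists (world_of c); rewrite ?mem_enum //=.
Qed.

Definition truth (p : form) : {set world} := [set t | holds (val t) p]%SET.

Lemma beval_char_form_truth v p : consistent (type_of v) -> p \in S ->
  beval v (char_form (truth p)) = beval v p.
Proof. by move=> c pS; rewrite (beval_char_form c) inE /= holds_type_of. Qed.

(** Adding [inconsistencies] to the premises restricts the check to valuations whose type is a
    world. *)
Lemma char_entails (C : seq form) p :
  (forall v, consistent (type_of v) -> all (beval v) C -> beval v p) ->
  (forall q, q \in C -> T q) -> T p.
Proof.
move=> Cp CT; apply: (theory_entails T_th (C := inconsistencies ++ C)) => [q|v].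
  by rewrite mem_cat => /orP[/inconsistenciesT|/CT].
by rewrite all_cat => /andP[/inconsistenciesP c Cv]; exact: Cp.
Qed.

Lemma char_top (a : {set world}) : T (char_form a) -> a = [set: world]%SET.
Proof.
move=> Ta; apply/setP => t; rewrite inE.
have [] := world_val t (C := char_form a :: inconsistencies) _.
  by move=> p; rewrite inE => /predU1P[->//|]; exact: inconsistenciesT.
move=> v /= /andP[va /inconsistenciesP c] vt.
have -> : t = world_of c by exact: val_inj.
by rewrite -beval_char_form.
Qed.

(** On [S], membership in [T] becomes validity throughout the frame; this transfers the refutation
    of a rule to the algebra. *)
Lemma truth_top p : p \in S -> T p <-> truth p = [set: world]%SET.
Proof.
move=> pS; split => [Tp|pT].
  apply: char_top; apply: (char_entails (C := [:: p])) => [v c /=|q].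
    by rewrite beval_char_form_truth // andbT.
  by rewrite inE => /eqP ->.
apply: (char_entails (C := [::])) => // v c _.
by rewrite -beval_char_form_truth // (beval_char_form c) pT inE.
Qed.

Lemma world_ext (t : world) :
  exists2 v, type_of v = val t & forall p,
    p \in S -> holds (val t) p = beval v p.
Proof.
have [v _ vt] := world_val t (C := [::]) (fun p (h : p \in [::]) =>
  False_ind _ (notF h)).
by exists v => // p pS; rewrite -vt holds_type_of.
Qed.

Lemma truth_FBot : FBot \in S -> truth FBot = finset.set0.
Proof.
move=> pS; apply/setP => t; have [v _ vt] := world_ext t.
by rewrite !inE vt.
Qed.

Lemma truth_FTop : FTop \in S -> truth FTop = [set: world]%SET.
Proof.
move=> pS; apply/setP => t; have [v _ vt] := world_ext t.
by rewrite !inE vt.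
Qed.

Lemma truth_FAnd p q : FAnd p q \in S -> truth (FAnd p q) = (truth p :&: truth
  q)%SET.
Proof.
move=> pS; apply/setP => t; have [v _ vt] := world_ext t.
by rewrite !inE !vt //; apply: (S_closed pS);
  rewrite /= inE mem_cat subforms_refl ?orbT.
Qed.

Lemma truth_FOr p q : FOr p q \in S -> truth (FOr p q) = (truth p :|: truth
  q)%SET.
Proof.
move=> pS; apply/setP => t; have [v _ vt] := world_ext t.
by rewrite !inE !vt //; apply: (S_closed pS);
  rewrite /= inE mem_cat subforms_refl ?orbT.
Qed.

Lemma truth_FNeg p : FNeg p \in S -> truth (FNeg p) = (~: truth p)%SET.
Proof.
move=> pS; apply/setP => t; have [v _ vt] := world_ext t.
by rewrite !inE !vt //; apply: (S_closed pS);
  rewrite /= inE subforms_refl ?orbT.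
Qed.

Local Notation A := (frame_algebra acc).

(** Let [t] be in [box a]. A world containing [□ q] and [q] for all [□ q] of [S] true at [t] is a
    successor of [t], so lies in [a]. Hence [T] derives [char_form a] from these conjunctions, and
    boxing the derivation leaves [□ (□ q ∧ q)] to be derived from [□ q]. *)
Lemma char_box_sub (a : A) : T (char_form (box a) → □ char_form a)%M.
Proof.
pose K (t : world) := [seq p <- S |
  if p is FBox q then holds (val t) p else false].
pose unbox p := if p is FBox q then q else p.
have step (t : world) : t \in (box a : {set world}) ->
    T (type_form (val t) → □ char_form a)%M.
  move=> ta; pose C := [seq FAnd p (unbox p) | p <- K t].
  have TC : T (foldr FImp (char_form a) C).
    apply: (char_entails (C := [::])) => // v c _.
    rewrite beval_foldr_imp; apply/implyP => /allP Cv.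
    rewrite (beval_char_form c); move: ta;
      rewrite inE => /forallP/(_ (world_of c))/implyP.
    apply; apply/accP => q qS tq /=.
    have /Cv /= /andP[v1 v2] : FAnd (FBox q) q \in C.
      by apply/mapP; exists (FBox q) => //; rewrite mem_filter qS tq.
    rewrite !holds_type_of //; apply: (S_closed qS).
    by rewrite /= inE subforms_refl orbT.
  have TbC := theory_box_imp T_th TC.
  (* Transitivity enters here: [□ q] gives [□ □ q], hence [□ (□ q ∧ q)]. *)
  have boxC p : p \in K t -> T (p → □ (p ∧ unbox p))%M.
    rewrite mem_filter; case: p => // q _ /=.
    have := theory_box_imp T_th (C := [:: FBox q; q]) (q := (□ q ∧ q)%M).
    move=> /= Tq; apply: (theory_entails T_th (C := [:: (□ □ q → □ q →
      □ (□ q ∧ q)); (□ q → □ □ q)]%M)).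
      move=> r; rewrite !inE => /orP[] /eqP -> //; apply: Tq.
      by apply: nth_taut => // v /=; case: (v _) => //=; case: beval.
    by move=> v /=; do !case: (v _) => //=.
  apply: (theory_entails T_th
     (C := foldr FImp (□ char_form a)%M [seq (□ p)%M |
       p <- C] :: [seq FImp p (□ (p ∧ unbox p))%M | p <- K t])).
    by move=> r; rewrite inE => /predU1P[-> //|/mapP[p pK ->]]; exact: boxC.
  move=> v; rewrite [all _ _]/= beval_foldr_imp => /andP[/implyP h /allP Kv].
  rewrite [beval _ _]/= beval_type_form; case: eqP => //= vt; apply: h.
  apply/allP => _ /mapP[_ /mapP[p pK ->] ->].
  have /Kv /= : FImp p (□ (p ∧ unbox p))%M \in [seq FImp p (□ (p ∧ unbox p))%M
    | p <- K t].
    exact: map_f.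
  suff -> : beval v p by [].
  move: pK; rewrite mem_filter => /andP[]; case: p => // q tq qS.
  by rewrite -holds_type_of // vt.
apply: (char_entails (C := [seq FImp (type_form (val t)) (□ char_form a)%M |
  t <- enum (box a : {set world})])).
  move=> v c /allP h; rewrite [beval _ _]/= (beval_char_form c).
  case: (boolP (_ \in _)) => //= va.
  have /h /= : FImp (type_form (type_of v)) (□ char_form a)%M \in
    [seq FImp (type_form (val t)) (□ char_form a)%M |
      t <- enum (box a : {set world})].
    by apply/mapP; exists (world_of c); rewrite ?mem_enum.
  by rewrite beval_type_form eqxx.
by move=> q /mapP[t]; rewrite mem_enum => ta ->; exact: step.
Qed.

Lemma box_char_truth p : p \in S -> T (□ char_form (truth p) → □ p)%M.
Proof.
move=> pS; apply: (theory_box_imp T_th (C := [:: char_form (truth p)])).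
apply: (char_entails (C := [::])) => // v c _ /=.
by rewrite beval_char_form_truth // orNb.
Qed.

(** One inclusion is read off [acc]. For the other, a valuation realising [t] is chosen to satisfy
    [char_box_sub] and [box_char_truth], which together carry [t] from [box (truth p)] to [□ p]. *)
Lemma truth_FBox p : FBox p \in S -> truth (FBox p) = box (truth p : A).
Proof.
move=> pS; have pS' : p \in S.
  by apply: (S_closed pS); rewrite /= inE subforms_refl orbT.
apply/setP => t; apply/idP/idP => [|tp].
  rewrite !inE => tp; apply/forallP => u.
  by apply/implyP => /accP tu; rewrite inE; case: (tu _ pS tp).
have [] := world_val t (C := [:: char_form (box (truth p : A)) →
  □ char_form (truth p);
  □ char_form (truth p) → □ p]%M ++ inconsistencies) _.
  move=> q; rewrite mem_cat => /orP[|/inconsistenciesT //].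
  rewrite !inE => /orP[] /eqP ->; [exact: char_box_sub|exact: box_char_truth].
move=> v; rewrite all_cat => /andP[+ /inconsistenciesP c] vt.
have tE : t = world_of c by exact: val_inj.
rewrite /= (beval_char_form c) -tE tp /= inE -vt holds_type_of //=.
by case: (v _) => //=; rewrite andbT.
Qed.

(** The converse of [char_box_sub] is gained on values of formulas whose box is in [S]:
    [□ char_form (truth p)] implies [□ p], which agrees with the characteristic formula of its own
    value. *)
Lemma char_box p : FBox p \in S ->
  T (char_form (box (truth p : A)) ↔ □ char_form (truth p))%M.
Proof.
move=> pS; have pS' : p \in S.
  by apply: (S_closed pS); rewrite /= inE subforms_refl orbT.
apply: (char_entails (C := [:: char_form (box (truth p : A)) →
  □ char_form (truth p);
  □ char_form (truth p) → □ p]%M)) => [v c|q].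
  rewrite -truth_FBox //= beval_char_form_truth //=.
  by do !case: (v _) => //=.
by rewrite !inE => /orP[] /eqP ->; [exact: char_box_sub|exact: box_char_truth].
Qed.

End Filtration.

(** * Unpacking the premises and conclusions of a pre-stable rule *)

Section Premises.
Variables (d : Order.disp_t) (A : finModalAlgebraType d) (Dp D : {set A}).

(** An arbitrary [P] lets the equivalence serve both to use premises lying in a theory and to prove
    that their substitution instances lie in one. *)
Lemma prestable_premP (P : form -> Prop) :
  (forall p, p \in prestable_prem Dp D -> P p) <->
  [/\ forall a b : A, P (pvar (a `&` b)%O ↔ pvar a ∧ pvar b)%M,
      forall a b : A, P (pvar (a `|` b)%O ↔ pvar a ∨ pvar b)%M,
      forall a : A, P (pvar (~` a)%O ↔ ¬ pvar a)%M,
      forall a : A, P (pvar (boxp a) → □⁺ pvar a)%M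
    & (forall a : A, a \in Dp -> P (□⁺ pvar a → pvar (boxp a))%M) /\
      (forall a : A, a \in D -> P (pvar (box a) ↔ □ pvar a)%M)].
Proof.
split=> [h|[h1 h2 h3 h4 [h5 h6]] p].
  split=> [a b|a b|a|a|]; last (split=> a aD); apply: h.
  - by do 5 (apply/fsetUP; left); apply/imfset2P; exists a => //; exists b.
  - do 4 (apply/fsetUP; left); apply/fsetUP; right.
    by apply/imfset2P; exists a => //; exists b.
  - do 3 (apply/fsetUP; left); apply/fsetUP; right.
    by apply/imfsetP; exists a.
  - do 2 (apply/fsetUP; left); apply/fsetUP; right.
    by apply/imfsetP; exists a.
  - by apply/fsetUP; left; apply/fsetUP; right; apply/imfsetP; exists a.
  - by apply/fsetUP; right; apply/imfsetP; exists a.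
rewrite !in_fsetU -!orbA => /orP[/imfset2P[a _ [b _ ->]] //|].
move=> /orP[/imfset2P[a _ [b _ ->]] //|/orP[/imfsetP[a _ ->] //|]].
move=> /orP[/imfsetP[a _ ->] //|].
by move=> /orP[/imfsetP[a /= aD ->]|/imfsetP[a /= aD ->]]; auto.
Qed.

Lemma prestable_conclP (p : form) :
  reflect (exists2 a : A, a != \top%O & p = pvar a) (p \in prestable_concl A).
Proof. by apply: (iffP (imfsetP _ _ _ _)). Qed.

End Premises.

(** * The two substitutions linking formulas with elements of the algebra *)

Section Main.
Variables (T : set form) (S : {fset form}).
Hypotheses (T_th : normal_theory T) (T4 : forall p, T (□ p → □ □ p)%M).
Hypothesis S_closed : sub_closed S.

Local Notation A := (frame_algebra (@acc T S)).
Local Notation val_ p := (truth T S p : A).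

Definition box_domain : {set A} :=
  [set a | has (fun p => if p is FBox q then a == val_ q else false) S]%SET.

Lemma box_domainP (a : A) :
  reflect (exists2 q, FBox q \in S & a = val_ q) (a \in box_domain).
Proof.
rewrite inE; apply: (iffP hasP) => [[[] // q qS /eqP ->]|[q qS ->]].
  by exists q.
by exists (FBox q).
Qed.

Local Notation prem := (prestable_prem finset.set0 box_domain).

(** Indexing the enumeration inverts [enum_rank] from [pvar]; the default [\top] is reached only at
    variables that are no [pvar a]. *)
Definition char_subst (n : nat) : form :=
  char_form (nth (\top%O : A) (enum {: A}) n : {set world T S}).

Lemma char_substE (a : A) : subst char_subst (pvar a) = char_form a.
Proof. by rewrite /= /char_subst nth_enum_rank. Qed.

(** The Boolean premises hold at each world by membership, the [□⁺] implications follow from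
    [char_box_sub], and the box equivalences on [box_domain] are [char_box]. *)
Lemma char_subst_prem p : p \in prem -> T (subst char_subst p).
Proof.
move: p; apply/prestable_premP.
split; [move=> a b|move=> a b|move=> a|move=> a|split=> a];
  rewrite -?[subst _ _]/(FIff (subst _ _) _) /FBoxp;
  rewrite [subst _ _]/= /char_subst !nth_enum_rank.
- apply: (char_entails T_th (C := [::])) => // v c _ /=.
  by rewrite !(beval_char_form c) meetEsubset inE;
    case: (world_of c \in (a : {set world T S}));
    case: (world_of c \in (b : {set world T S})).
- apply: (char_entails T_th (C := [::])) => // v c _ /=.
  by rewrite !(beval_char_form c) joinEsubset inE;
    case: (world_of c \in (a : {set world T S}));
    case: (world_of c \in (b : {set world T S})).
- apply: (char_entails T_th (C := [::])) => // v c _ /=.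
  by rewrite !(beval_char_form c) complEsubset inE;
    case: (world_of c \in (a : {set world T S})).
- apply: (char_entails T_th (C := [:: (char_form (box a) →
    □ char_form a)%M])) => [v c /=|q].
    rewrite !(beval_char_form c) /boxp meetEsubset finset.in_setI.
    by case: (v _) => /=;
      case: (world_of c \in (box a : {set world T S})) => //=;
      case: (world_of c \in (a : {set world T S})).
  by rewrite inE => /eqP ->; exact: char_box_sub.
- by rewrite inE.
- by move=> /box_domainP[q qS ->]; exact: char_box.
Qed.

Lemma char_subst_concl p : p \in prestable_concl A -> ~ T (subst char_subst p).
Proof.
move=> /prestable_conclP[a aT ->]; rewrite char_substE => /(char_top T_th) aE.
by move: aT; rewrite topEsubset aE eqxx.
Qed.

Definition truth_subst (n : nat) : form := pvar (val_ (Var n)).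

Variable T' : set form.
Hypotheses (T'_th : normal_theory T') (T'_prem : forall p, p \in prem -> T' p).

Lemma pvar_top : T' (pvar (\top%O : A)).
Proof.
have [_ h2 h3 _ _] := (prestable_premP _ _ _).1 T'_prem.
apply: (theory_entails T'_th (C :=
  [:: (pvar (\top `|` ~` \top : A)%O ↔ pvar (\top : A)%O ∨ pvar (~` \top :
  A)%O)%M;
  (pvar (~` \top : A)%O ↔ ¬ pvar (\top : A)%O)%M])).
  by move=> r; rewrite !inE => /orP[] /eqP ->.
(* The join of [\top] and its complement is [\top], so the premises turn [pvar \top] into an
   instance of excluded middle. *)
rewrite Order.CTBDistrLatticeTheory.joinxC => v /=.
by do !case: (v _) => //=.
Qed.

Lemma pvar_bot : T' (¬ pvar (\bot%O : A))%M.
Proof.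
have [_ _ h3 _ _] := (prestable_premP _ _ _).1 T'_prem.
apply: (theory_entails T'_th (C := [:: pvar (\top : A)%O;
  (pvar (~` \top : A)%O ↔ ¬ pvar (\top : A)%O)%M])).
  by move=> r; rewrite !inE => /orP[] /eqP -> //; exact: pvar_top.
by rewrite Order.CTBDistrLatticeTheory.compl1 => v /=; do !case: (v _) => //=.
Qed.

(** By induction on [p], each connective matched by a premise of the rule; the box case is available
    because [box_domain] contains the value of every formula whose box is in [S]. *)
Lemma truth_subst_iff p : p \in S -> T' (subst truth_subst p ↔ pvar (val_ p))%M.
Proof.
have [h1 h2 h3 _ [_ h6]] := (prestable_premP _ _ _).1 T'_prem.
elim: p => [n|||p IHp q IHq|p IHp q IHq|p IHp|p IHp] pS.
- by apply: nth_taut => // v /=; case: (v _).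
- rewrite (truth_FBot T_th pS);
    apply: (theory_entails T'_th (C := [:: (¬ pvar (\bot%O : A))%M])).
    by move=> r; rewrite !inE => /eqP ->; exact: pvar_bot.
  by move=> v /=; rewrite botEsubset; case: (v _).
- rewrite (truth_FTop T_th pS);
    apply: (theory_entails T'_th (C := [:: (pvar (\top%O : A))%M])).
    by move=> r; rewrite !inE => /eqP ->; exact: pvar_top.
  by move=> v /=; rewrite topEsubset; case: (v _).
- have pS1 : p \in S by apply: (S_closed pS);
    rewrite /= inE mem_cat subforms_refl ?orbT.
  have qS1 : q \in S by apply: (S_closed pS);
    rewrite /= inE mem_cat subforms_refl ?orbT.
  rewrite (truth_FAnd T_th S_closed pS).
  apply: (theory_entails T'_th (C :=
    [:: (pvar (val_ p `&` val_ q)%O ↔ pvar (val_ p) ∧ pvar (val_ q))%M;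
    (subst truth_subst p ↔ pvar (val_ p))%M;
      (subst truth_subst q ↔ pvar (val_ q))%M])).
    by move=> r; rewrite !inE => /or3P[] /eqP -> //; [exact: IHp|exact: IHq].
  move=> v /=; rewrite meetEsubset.
  by case: (beval v _) => /=; case: (beval v _) => /=; do !case: (v _) => //=.
- have pS1 : p \in S by apply: (S_closed pS);
    rewrite /= inE mem_cat subforms_refl ?orbT.
  have qS1 : q \in S by apply: (S_closed pS);
    rewrite /= inE mem_cat subforms_refl ?orbT.
  rewrite (truth_FOr T_th S_closed pS).
  apply: (theory_entails T'_th (C :=
    [:: (pvar (val_ p `|` val_ q)%O ↔ pvar (val_ p) ∨ pvar (val_ q))%M;
    (subst truth_subst p ↔ pvar (val_ p))%M;
      (subst truth_subst q ↔ pvar (val_ q))%M])).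
    by move=> r; rewrite !inE => /or3P[] /eqP -> //; [exact: IHp|exact: IHq].
  move=> v /=; rewrite joinEsubset.
  by case: (beval v _) => /=; case: (beval v _) => /=; do !case: (v _) => //=.
- have pS1 : p \in S by apply: (S_closed pS);
    rewrite /= inE subforms_refl ?orbT.
  rewrite (truth_FNeg T_th S_closed pS).
  apply: (theory_entails T'_th (C :=
    [:: (pvar (~` val_ p)%O ↔ ¬ pvar (val_ p))%M;
    (subst truth_subst p ↔ pvar (val_ p))%M])).
    by move=> r; rewrite !inE => /orP[] /eqP -> //; exact: IHp.
  move=> v /=; rewrite complEsubset.
  by case: (beval v _) => /=; do !case: (v _) => //=.
- have pS1 : p \in S by apply: (S_closed pS);
    rewrite /= inE subforms_refl ?orbT.
  rewrite (truth_FBox T_th T4 S_closed pS).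
  (* The induction hypothesis is a member of [T'], so necessitation and K make it a congruence under
     the box. *)
  have TB : T' (□ subst truth_subst p ↔ □ pvar (val_ p))%M.
    have TB1 := theory_box_imp T'_th (C := [:: subst truth_subst p]) (q :=
      pvar (val_ p)).
    have TB2 := theory_box_imp T'_th (C := [:: pvar (val_ p)]) (q :=
      subst truth_subst p).
    apply: (theory_entails T'_th (C := [:: (□ subst truth_subst p →
      □ pvar (val_ p));
       (□ pvar (val_ p) → □ subst truth_subst p)]%M)).
      move=> r; rewrite !inE => /orP[] /eqP ->; [apply: TB1|apply: TB2];
      apply: (theory_entails T'_th (C :=
        [:: (subst truth_subst p ↔ pvar (val_ p))%M])) => [s|v /=].
      - by rewrite !inE => /eqP ->; exact: IHp.
      - by case: (beval v _) => /=; case: (v _).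
      - by rewrite !inE => /eqP ->; exact: IHp.
      - by case: (beval v _) => /=; case: (v _).
    by move=> v /=; do !case: (v _) => //=.
  apply: (theory_entails T'_th (C :=
    [:: (pvar (box (val_ p)) ↔ □ pvar (val_ p))%M;
    (□ subst truth_subst p ↔ □ pvar (val_ p))%M])).
    move=> r; rewrite !inE => /orP[] /eqP -> //; apply: h6.
    by apply/box_domainP; exists p.
  by move=> v /=; do !case: (v _) => //=.
Qed.

End Main.

(** * Separating rule systems by pre-stable rules *)

Lemma NExt_closed_theory M T : NExt GLR M -> rule_closed M T ->
  normal_theory T /\ forall p, T (□ p → □ □ p)%M.
Proof.
move=> [M_sys GLM] MT; split; first exact: rule_closed_theory MT.
move=> p; apply: rule_closed_thm MT _; apply: GLM => N _; apply.
exact: GL_trans.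
Qed.

Lemma refuted_prestable M N G D : NExt GLR M -> NExt GLR N ->
  M (G, D) -> ~ N (G, D) -> exists r, [/\ K4_prestable_rules r, M r & ~ N r].
Proof.
move=> hM hN MGD NGD; have [T [NT GT DT]] := lindenbaum hN.1 NGD.
have [T_th T4] := NExt_closed_theory hN NT.
pose S := sub_closure (G `|` D)%fset.
have S_closed : sub_closed S := @sub_closure_closed _.
have GS p : p \in G -> p \in S.
  by move=> pG; apply: subset_sub_closure; rewrite inE pG.
have DS p : p \in D -> p \in S.
  by move=> pD; apply: subset_sub_closure; rewrite inE pD orbT.
pose A := frame_algebra (@acc T S).
pose r := prestable_rule finset.set0 (@box_domain T S).
exists r; split.
- exists _, A, finset.set0, (@box_domain T S); split => //.
  exact/frame_algebra_K4/acc_trans.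
- apply: contrapT => Mr; have [T' [MT' prem' concl']] := lindenbaum hM.1 Mr.
  have [T'_th _] := NExt_closed_theory hM MT'.
  have iffS p (pS : p \in S) := truth_subst_iff T_th T4 S_closed T'_th prem' pS.
  (* The substituted rule is in [M], yet [T'] contains all its premises and none of its
     conclusions. *)
  have := mrs_subst hM.1 (truth_subst T S) MGD.
  move=> /MT'[p /imfsetP[q /= qG ->]|_ /imfsetP[q /= qD ->] Tq].
    apply: (theory_entails T'_th (C :=
      [:: (subst (truth_subst T S) q ↔ pvar (truth T S q : A))%M;
        pvar (truth T S q : A)])).
      move=> s; rewrite !inE => /orP[] /eqP ->; first exact/iffS/GS.
      have /(truth_top T_th (GS _ qG)) -> := GT _ qG.
      exact: (pvar_top T'_th prem').
    by move=> v /=; case: (beval v _) => //=; case: (v _).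
  (* If the value of [q] were not [\top], its variable would be a conclusion of the pre-stable rule
     lying in [T']. *)
  apply: (DT _ qD); apply/(truth_top T_th (DS _ qD)).
  apply: contrapT => /eqP qT; apply: (concl' (pvar (truth T S q : A))).
    by apply/prestable_conclP; exists (truth T S q : A).
  apply: (theory_entails T'_th (C :=
    [:: (subst (truth_subst T S) q ↔ pvar (truth T S q : A))%M;
     subst (truth_subst T S) q])).
    by move=> s; rewrite !inE => /orP[] /eqP -> //; exact/iffS/DS.
  by move=> v /=; case: (beval v _) => //=; case: (v _).
(* Under [char_subst], [T] contains every premise and no conclusion, although it is closed under
   [N]. *)
- move=> Nr; have := mrs_subst hN.1 (char_subst T S) Nr.
  move=> /NT[p /imfsetP[q /= qP ->]|_ /imfsetP[q /= qC ->]].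
    exact: (char_subst_prem T_th T4 S_closed).
  exact: (char_subst_concl T_th).
Qed.

Theorem theorem5p26 (M : set rule) (hM : NExt GLR M) :
  exists X : set rule, X `<=` K4_prestable_rules /\ axiomatised_over GLR X M.
Proof.
(* The largest candidate is taken, so only the inclusion of [M] in the generated system needs the
   separation argument. *)
exists (M `&` K4_prestable_rules); split; first by move=> r [].
apply/seteqP; split => [[G D] MGD N hN MN|r]; last by apply => // s [].
apply: contrapT => NGD.
by have [r [rK Mr]] := refuted_prestable hM hN MGD NGD; apply; exact: MN.
Qed.
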